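(* Let $\mathfrak{M}=(n,\mathcal{G},\{P_i,r_i\}_{i=1}^n)$ be a problem instance whose rewards are bounded by $\bar r$, and suppose that $\mathfrak{M}$ has the $(C,\rho)$-fast decaying property. Then for every integer $k\ge 1$ and every local policy $\zeta=(\zeta_1,\ldots,\zeta_n)\in\Gamma$, $$\frac{1}{n}\,\bigl|R(\zeta)-\hat R^k(\zeta)\bigr|\;\le\; C\,\bar r\,\rho^k .$$
   Context: **Problem instance.** There are $n$ agents $\mathcal N=\{1,\dots,n\}$; agent $i$ has state $s_i\in\{0,1\}$ and action $a_i\in\{0,1\}$. $\mathcal G$ is a directed tree on $\mathcal N$ rooted at node $1$. For a node $i$, $\delta_i^1$ is its parent and $\delta_i^k$ its $k$-hop parent (ancestor at distance $k$). $\Delta_i^k=(i,\delta_i^1,\dots,\delta_i^k)$ is the path from $i$ to its $k$-hop parent; if $i$ has no $k$-hop parent, $\Delta_i^k$ is the path from $i$ to the root. Given global state $s(t)$ and action $a(t)$, the next states are independent across agents: $$P(s(t+1)\mid s(t),a(t))=\prod_{i=1}^n P_i(s_i(t+1)\mid s_i(t),s_{\delta_i^1}(t),a_i(t)),$$ where for the root $i=1$ the factor is $P_1(s_1(t+1)\mid s_1(t),a_1(t))$. Agent $i$ has reward $r_i:\{0,1\}\to\mathbb R$, also viewed as a vector in $\mathbb R^2$, with $|r_i(s)|\le\bar r$ for all $i$ and $s$. **Local policies.** $\Gamma_i$ is the set of all $4$ maps $\zeta_i:\{0,1\}\to\{0,1\}$ (agent $i$ plays $a_i(t)=\zeta_i(s_i(t))$),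 and $\Gamma=\Gamma_1\times\cdots\times\Gamma_n$. For a tuple of nodes $D$, $\zeta_D=(\zeta_j)_{j\in D}$. **Standing assumption.** For each $i$, each $\zeta_i\in\Gamma_i$ and each fixed parent state $u\in\{0,1\}$, the two-state chain with transition matrix $P_i(s_i(t+1)\mid s_i(t),s_{\delta_i^1}(t)=u,a_i(t)=\zeta_i(s_i(t)))$ is ergodic. Consequently, under every $\zeta\in\Gamma$ the global chain has a unique stationary distribution $\pi(\zeta)$; $\pi_i(\zeta)$ denotes its marginal on $s_i$. **True reward.** $R_i(\zeta)=r_i^T\pi_i(\zeta)$ and $R(\zeta)=\sum_{i=1}^n R_i(\zeta)$ (the long-run average reward). **Truncated model.** For node $i$ and integer $k\ge1$, the truncated model is the Markov chain on $(s_j)_{j\in\Delta_i^k}$ in which, if $i$ has a $k$-hop parent, the nodes $i,\delta_i^1,\dots,\delta_i^{k-1}$ evolve with their original transition probabilities (independently given the current states), and $s_{\delta_i^k}(t)$ is drawn uniformly from $\{0,1\}$ at every time, independently of everything else. If $i$ has no $k$-hop parent, all nodes on the path from $i$ to the root evolve with their original transition probabilities (nothing is truncated). Under policies $\zeta_{\Delta_i^k}$, $\hat\pi_i^k(\zeta_{\Delta_i^k})$ is the marginal on $s_i$ of the stationary distribution of this chain. Set $\hat R_i^k(\zeta_{\Delta_i^k})=r_i^T\hat\pi_i^k(\zeta_{\Delta_i^k})$ and $\hat R^k(\zeta)=\sum_{i=1}^n\hat R_i^k(\zeta_{\Delta_i^k})$. **Fast decaying property.** For real numbers $C,\rho$,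 $\mathfrak M$ has the $(C,\rho)$-fast decaying property if for every $i$, every $\zeta\in\Gamma$ and every integer $k\ge1$, $\|\pi_i(\zeta)-\hat\pi_i^k(\zeta_{\Delta_i^k})\|_1\le C\rho^k$. *)

(* Defs.v *)
From mathcomp Require Import all_boot all_order all_algebra.
From mathcomp Require Import boolp classical_sets reals.

Set Implicit Arguments.
Unset Strict Implicit.
Unset Printing Implicit Defensive.

Import Order.TTheory GRing.Theory Num.Theory.
Local Open Scope ring_scope.

Section MarkovChains.
Variables (R : realType) (S : finType).
Implicit Types (K : S -> S -> R) (mu : {ffun S -> R}).

Definition is_dist (mu : S -> R) : Prop :=
  (forall x, 0 <= mu x) /\ \sum_x mu x = 1.

(* [K x y] is the probability of moving from [x] to [y]. *)
Definition stochastic K : Prop := forall x, is_dist (K x).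

Fixpoint step_prob K (t : nat) (x y : S) : R :=
  if t is t'.+1 then \sum_z K x z * step_prob K t' z y else (x == y)%:R.

Definition irreducible_chain K : Prop :=
  forall x y, exists t, 0 < step_prob K t x y.

(* The gcd of the return times of every state is 1; the time [t = 0] is
   divisible by every [d] and imposes nothing. *)
Definition aperiodic_chain K : Prop :=
  forall x (d : nat),
    (forall t, 0 < step_prob K t x x -> (d %| t)%N) -> d = 1%N.

Definition ergodic_chain K : Prop := irreducible_chain K /\ aperiodic_chain K.

Definition stationary K mu : Prop :=
  is_dist mu /\ forall y, \sum_x mu x * K x y = mu y.

(* The chosen stationary distribution, with the junk value 0 if there is none.
   [global_stationaryP] and [trunc_stationaryP] show that, for the chains used
   here, it exists and is unique. *)
Definition stat_dist K : {ffun S -> R} :=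
  xget [ffun=> 0] [set mu | stationary K mu]%classic.

End MarkovChains.

(* Chains on {0,1}^I whose coordinates move independently given the current
   state: [q i s] is the law of the next value of coordinate [i]. *)
Definition product_kernel (R : realType) (I : finType)
    (q : I -> {ffun I -> bool} -> bool -> R) (s s' : {ffun I -> bool}) : R :=
  \prod_i q i s (s' i).

Definition marginal (R : realType) (I : finType)
    (mu : {ffun {ffun I -> bool} -> R}) (i : I) (x : bool) : R :=
  \sum_(s : {ffun I -> bool} | s i == x) mu s.

Section RootedTrees.
Variables (n : nat) (e : rel 'I_n).

(* [e j i] is the arc from [j] to its child [i]; every node is the end of
   exactly one directed walk starting at the root. *)
Definition rooted_tree (root : 'I_n) : Prop :=
  forall i, exists! p : seq 'I_n, path e root p /\ last root p = i.

Definition parent_of (i : 'I_n) : option 'I_n := [pick j | e j i].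

End RootedTrees.

(* Node 1 is the ordinal 0, and states and actions in {0,1} are booleans.
   [trans i s' s u a] is P_i(s' | s, u, a), where [u] is [Some] of the state of
   the parent of [i] if [i] has a parent and [None] if [i] is the root; the
   values of [trans] at the other [u] are never used. *)
Record instance (R : realType) := Instance {
  agents : nat;
  agents_gt0 : (0 < agents)%N;
  arc : rel 'I_agents;
  arc_tree : rooted_tree arc (Ordinal agents_gt0);
  trans : 'I_agents -> bool -> bool -> option bool -> bool -> R;
  trans_dist : forall i s u a, isSome u = isSome (parent_of arc i) ->
    is_dist (fun s' => trans i s' s u a);
  rew : 'I_agents -> bool -> R
}.

Section Model.
Variables (R : realType) (M : instance R).
Local Notation n := (agents M).

Definition parent : 'I_n -> option 'I_n := parent_of (@arc R M).

Definition kparent (k : nat) (i : 'I_n) : option 'I_n :=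
  iter k (obind parent) (Some i).

(* The path Delta_i^k; ancestors above the root are dropped. *)
Definition anc_path (k : nat) (i : 'I_n) : seq 'I_n :=
  pmap (fun l => kparent l i) (iota 0 k.+1).

Definition local_policy := bool -> bool.
Definition policy := 'I_n -> local_policy.

Definition ergodic_assumption : Prop :=
  forall (i : 'I_n) (z : local_policy) (u : option bool),
    isSome u = isSome (parent i) ->
    ergodic_chain (fun s s' => trans i s' s u (z s)).

Definition global_step (zeta : policy) (i : 'I_n) (s : {ffun 'I_n -> bool})
    (s' : bool) : R :=
  trans i s' (s i) (omap s (parent i)) (zeta i (s i)).

Definition global_kernel (zeta : policy) := product_kernel (global_step zeta).

Definition true_marginal (zeta : policy) (i : 'I_n) (x : bool) : R :=
  marginal (stat_dist (global_kernel zeta)) i x.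

Definition reward_at (zeta : policy) (i : 'I_n) : R :=
  \sum_(x : bool) rew i x * true_marginal zeta i x.

Definition reward (zeta : policy) : R := \sum_(i < n) reward_at zeta i.

Section Truncation.
Variables (k : nat) (i : 'I_n).

Definition trunc_node := {j : 'I_n | j \in anc_path k i}.
Definition trunc_policy := trunc_node -> local_policy.

Definition restrict_policy (zeta : policy) : trunc_policy :=
  fun j => zeta (val j).

Definition trunc_parent (j : trunc_node) : option trunc_node :=
  obind insub (parent (val j)).

Definition trunc_step (zeta : trunc_policy) (j : trunc_node)
    (s : {ffun trunc_node -> bool}) (s' : bool) : R :=
  if kparent k i == Some (val j) then 2^-1
  else trans (val j) s' (s j) (omap s (trunc_parent j)) (zeta j (s j)).

Definition trunc_kernel (zeta : trunc_policy) :=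
  product_kernel (trunc_step zeta).

Lemma anc_path_self : i \in anc_path k i.
Proof. by rewrite /anc_path /= mem_head. Qed.

Definition trunc_marginal (zeta : trunc_policy) (x : bool) : R :=
  marginal (stat_dist (trunc_kernel zeta)) (exist _ i anc_path_self) x.

Definition trunc_reward_at (zeta : trunc_policy) : R :=
  \sum_(x : bool) rew i x * trunc_marginal zeta x.

End Truncation.

Definition trunc_reward (k : nat) (zeta : policy) : R :=
  \sum_(i < n) trunc_reward_at (@restrict_policy k i zeta).

Definition bounded_rewards (rbar : R) : Prop :=
  forall (i : 'I_n) (x : bool), `|rew i x| <= rbar.

Definition fast_decaying (C rho : R) : Prop :=
  forall (i : 'I_n) (zeta : policy) (k : nat), (1 <= k)%N ->
    \sum_(x : bool) `|true_marginal zeta i x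
                       - trunc_marginal (@restrict_policy k i zeta) x|
      <= C * rho ^+ k.

End Model.

(* The stationary distributions above exist and are unique: couple two copies
   of the chain, starting from the root of the tree. *)

Section StationaryTheory.
Variables (R : realType) (S : finType).
Implicit Types (K : S -> S -> R) (f g d : S -> R).

Definition invariant_fun K f : Prop := forall y, \sum_x f x * K x y = f y.

Lemma abs_invariant K d :
  stochastic K -> invariant_fun K d -> invariant_fun K (fun x => `|d x|).
Proof.
move=> stK invd.
have ge0 y : 0 <= \sum_x `|d x| * K x y - `|d y|.
  rewrite subr_ge0 -{1}(invd y); apply: le_trans (ler_norm_sum _ _ _) _.
  by apply: ler_sum => x _; rewrite normrM (ger0_norm ((stK x).1 y)).
have sum0 : \sum_y (\sum_x `|d x| * K x y - `|d y|) = 0.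
  rewrite big_split /= sumrN exchange_big /=; apply/eqP; rewrite subr_eq0.
  by apply/eqP/eq_bigr => x _; rewrite -mulr_sumr (stK x).2 mulr1.
move=> y; apply/eqP; rewrite -subr_eq0; apply/eqP.
exact: (psumr_eq0P (fun z _ => ge0 z) sum0).
Qed.

Lemma nonzero_invariant K (x0 : S) :
  stochastic K -> exists2 d : S -> R, invariant_fun K d & exists x, d x != 0.
Proof.
move=> stK.
pose A : 'M[R]_#|S| := \matrix_(i, j) (K (enum_val i) (enum_val j) - (i == j)%:R).
have A1 : A *m const_mx 1 = 0 :> 'cV_#|S|.
  apply/matrixP => i j; rewrite !mxE.
  under eq_bigr => l _ do rewrite !mxE mulr1.
  rewrite big_split /= sumrN; set d := (X in _ - X).
  have -> : d = 1.
    rewrite /d (bigD1 i) //= eqxx big1 ?addr0 // => l /negPf li.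
    by rewrite eq_sym li.
  rewrite -(stK (enum_val i)).2 [X in _ - X](reindex (@enum_val S (mem S))) /=.
    by rewrite subrr.
  by apply: onW_bij; exact: enum_val_bij.
have detA : \det A = 0.
  apply/eqP; apply/negPn/negP => detA.
  have uA : A \in unitmx by rewrite unitmxE unitfE.
  have /matrixP/(_ (enum_rank x0) 0) : const_mx 1 = 0 :> 'cV[R]_#|S|.
    by rewrite -(mulKmx uA (const_mx 1)) A1 mulmx0.
  by rewrite !mxE => /eqP; rewrite oner_eq0.
have /det0P[v vn0 vA] : \det A == 0 by rewrite detA.
exists (fun x => v 0 (enum_rank x)) => [y|]; last first.
  apply: contrapT => nex; move/eqP: vn0; apply; apply/rowP => j; rewrite mxE.
  apply/eqP/negPn/negP => vj; apply: nex; exists (enum_val j).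
  by rewrite enum_valK.
move/matrixP: vA => /(_ 0 (enum_rank y)); rewrite !mxE.
under eq_bigr => l _ do rewrite !mxE enum_rankK mulrBr.
rewrite big_split /= sumrN => /eqP; rewrite subr_eq0 => /eqP.
rewrite [X in _ = X](bigD1 (enum_rank y)) //= eqxx mulr1 [X in _ = _ + X]big1 ?addr0.
  move=> <-; rewrite (reindex (@enum_val S (mem S))) /=.
    by apply: eq_bigr => i _; rewrite enum_valK.
  by apply: onW_bij; exact: enum_val_bij.
by move=> l /negPf ->; rewrite mulr0.
Qed.

Lemma stationary_exists K (x0 : S) :
  stochastic K -> exists mu : {ffun S -> R}, stationary K mu.
Proof.
move=> stK; have [d invd [x dx]] := nonzero_invariant x0 stK.
pose Z := \sum_x `|d x|.
have Z0 : 0 < Z.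
  rewrite /Z (bigD1 x) //=; apply: ltr_pwDl; first by rewrite normr_gt0.
  by apply: sumr_ge0.
exists [ffun x => `|d x| / Z]; split; first split=> [y|].
- by rewrite ffunE divr_ge0 // ltW.
- under eq_bigr => y _ do rewrite ffunE.
  by rewrite -mulr_suml divff // gt_eqF.
- move=> y; rewrite ffunE -(abs_invariant stK invd y) mulr_suml.
  by apply: eq_bigr => z _; rewrite ffunE mulrAC.
Qed.

Lemma stationary_unique K (mu nu : {ffun S -> R}) :
  stochastic K ->
  (forall f g, (forall x, 0 <= f x) -> (forall x, 0 <= g x) ->
     invariant_fun K f -> invariant_fun K g ->
     (exists x, 0 < f x) -> (exists x, 0 < g x) ->
     exists x, 0 < f x /\ 0 < g x) ->
  stationary K mu -> stationary K nu -> mu = nu.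
Proof.
move=> stK meet [[_ mu1] invm] [[_ nu1] invn].
pose d x := mu x - nu x.
have invd : invariant_fun K d.
  move=> y; rewrite /d -(invm y) -(invn y) -sumrB.
  by apply: eq_bigr => x _; rewrite mulrBl.
have sd : \sum_x d x = 0 by rewrite sumrB mu1 nu1 subrr.
have inva := abs_invariant stK invd.
have [/forallP d0|/forallPn[x dx]] := boolP [forall x, d x == 0].
  by apply/ffunP => x; apply/eqP; rewrite -subr_eq0; exact: d0.
pose f x := `|d x| + d x; pose g x := `|d x| - d x.
have f0 y : 0 <= f y by rewrite /f -lerBlDr sub0r -normrN ler_norm.
have g0 y : 0 <= g y by rewrite /g subr_ge0 ler_norm.
have invf : invariant_fun K f.
  move=> y; rewrite /f -{1}(inva y) -{1}(invd y) -big_split /=.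
  by apply: eq_bigr => z _; rewrite mulrDl.
have invg : invariant_fun K g.
  move=> y; rewrite /g -{1}(inva y) -{1}(invd y) -sumrB.
  by apply: eq_bigr => z _; rewrite mulrBl.
have sa : 0 < \sum_x `|d x|.
  rewrite (bigD1 x) //=; apply: ltr_pwDl; first by rewrite normr_gt0.
  by apply: sumr_ge0.
have pos (h : S -> R) : (forall y, 0 <= h y) -> 0 < \sum_y h y ->
    exists y, 0 < h y.
  move=> h0 sh; apply: contrapT => nex; move: sh.
  rewrite big1 ?ltxx // => y _; apply/eqP; rewrite eq_le h0 andbT leNgt.
  by apply/negP => hy; apply: nex; exists y.
have [||y [fy gy]] := meet f g f0 g0 invf invg => //.
- by apply: pos => //; rewrite big_split /= sd addr0.
- by apply: pos => //; rewrite sumrB sd subr0.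
have : 0 < f y * g y by apply: mulr_gt0.
by rewrite /f /g mulrC -subr_sqr real_normK ?num_real // subrr ltxx.
Qed.

Lemma invariant_pos K f x y :
  stochastic K -> (forall z, 0 <= f z) -> invariant_fun K f ->
  0 < f x -> 0 < K x y -> 0 < f y.
Proof.
move=> stK f0 invf fx Kxy; rewrite -(invf y) (bigD1 x) //=.
apply: ltr_pwDl; first exact: mulr_gt0.
by apply: sumr_ge0 => z _; apply: mulr_ge0 => //; exact: (stK z).1.
Qed.

Lemma stat_distP K :
  (exists! mu : {ffun S -> R}, stationary K mu) ->
  forall mu, stationary K mu <-> mu = stat_dist K.
Proof.
move=> [nu [stnu uniq]].
have sK : stationary K (stat_dist K).
  by rewrite /stat_dist; apply: (@xgetI _ _ [set mu | stationary K mu]%classic nu).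
by move=> mu; split=> [/uniq <-|-> //]; exact: uniq.
Qed.

End StationaryTheory.

Lemma is_dist_pos (R : realType) (S : finType) (mu : S -> R) :
  is_dist mu -> exists x, 0 < mu x.
Proof.
move=> [mu0 mu1]; apply: contrapT => nex.
have : \sum_x mu x = 0.
  apply: big1 => y _; apply/eqP; rewrite eq_le mu0 andbT leNgt.
  by apply/negP => hy; apply: nex; exists y.
by rewrite mu1 => /eqP; rewrite oner_eq0.
Qed.

Lemma ergodic_bool_common (R : realType) (K : bool -> bool -> R) :
  stochastic K -> ergodic_chain K ->
  forall x y, exists b, 0 < K x b /\ 0 < K y b.
Proof.
move=> stK [irr aper].
have K0 x y : 0 <= K x y := (stK x).1 y.
have off x : 0 < K x (~~ x).
  rewrite lt_def K0 andbT; apply/eqP => Kx.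
  have [t] := irr x (~~ x).
  have -> : step_prob K t x (~~ x) = 0; last by rewrite ltxx.
  elim: t => [|t IH] /=; first by case: (x).
  by case: x {irr} Kx IH => /= Kx IH; rewrite big_bool /= Kx IH !(mul0r, mulr0) addr0.
have diag : exists x, 0 < K x x.
  apply: contrapT => nex.
  have Kd x : K x x = 0.
    apply/eqP; rewrite eq_le K0 andbT leNgt; apply/negP => h; apply: nex.
    by exists x.
  have par t : forall x, (odd t -> step_prob K t x x = 0) /\
                   (~~ odd t -> step_prob K t (~~ x) x = 0).
    elim: t => [|t IH] x /=; first by case: x.
    have [e1 e2] := IH x; rewrite negbK !big_bool.
    case: x e1 e2 => /= e1 e2; split=> ot;
      rewrite ?Kd ?(e1 ot) ?(e2 ot) ?(mul0r, mulr0, addr0, add0r) //.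
  have /(_ _) := aper true 2%N; suff h : forall t, 0 < step_prob K t true true -> (2 %| t)%N.
    by move=> /(_ h).
  move=> t; rewrite dvdn2; case: (boolP (odd t)) => // ot.
  by rewrite ((par t true).1 ot) ltxx.
case: diag => b Kb x y; exists b.
have h z : 0 < K z b.
  by case: (eqVneq z b) => [-> //|]; case: z b Kb => [] [] // Kb _; exact: (off _).
by split; exact: h.
Qed.

Section ProductChains.
Variables (R : realType) (I : finType).
Variable q : I -> {ffun I -> bool} -> bool -> R.
Hypothesis q_dist : forall i s, is_dist (q i s).

Lemma product_kernel_stochastic : stochastic (product_kernel q).
Proof.
move=> s; split=> [s'|]; first by apply: prodr_ge0 => i _; exact: (q_dist i s).1.
rewrite /product_kernel -(bigA_distr_bigA (fun i b => q i s b)) /=.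
by apply: big1 => i _; exact: (q_dist i s).2.
Qed.

Variable rank : I -> nat.
Hypothesis q_common : forall i (x y : {ffun I -> bool}),
  (forall j, (rank j < rank i)%N -> x j = y j) ->
  exists b, 0 < q i x b /\ 0 < q i y b.

Lemma product_kernel_stationary :
  exists! mu : {ffun {ffun I -> bool} -> R}, stationary (product_kernel q) mu.
Proof.
have stK := product_kernel_stochastic.
have [mu smu] := stationary_exists [ffun=> true] stK.
exists mu; split=> // nu; apply: stationary_unique => // f g f0 g0 invf invg ef eg.
have step t : exists x y : {ffun I -> bool}, [/\ 0 < f x, 0 < g y &
    forall i, (rank i < t)%N -> x i = y i].
  elim: t => [|t [x [y [fx gy xy]]]].
    by case: ef => x fx; case: eg => y gy; exists x, y.
  have ch i : exists b : bool * bool, [/\ 0 < q i x b.1, 0 < q i y b.2 &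
      (rank i < t.+1)%N -> b.1 = b.2].
    case: (leqP t.+1 (rank i)) => it.
      have [b1 h1] := is_dist_pos (q_dist i x).
      by have [b2 h2] := is_dist_pos (q_dist i y); exists (b1, b2).
    have [j ji|b [h1 h2]] := @q_common i x y; last by exists (b, b).
    by apply: xy; exact: leq_trans ji _.
  have [F HF] := choice ch.
  exists [ffun i => (F i).1], [ffun i => (F i).2]; split.
  - apply: invariant_pos fx _ => //; apply: prodr_gt0 => i _.
    by rewrite ffunE; have [] := HF i.
  - apply: invariant_pos gy _ => //; apply: prodr_gt0 => i _.
    by rewrite ffunE; have [] := HF i.
  - by move=> i it; rewrite !ffunE; have [_ _] := HF i; apply.
have [x [y [fx gy xy]]] := step (\max_i rank i).+1.
have exy : x = y by apply/ffunP => i; apply: xy; rewrite ltnS; exact: leq_bigmax.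
by exists x; split=> //; rewrite exy.
Qed.

End ProductChains.

Section ModelTheory.
Variables (R : realType) (M : instance R).
Local Notation n := (agents M).
Hypothesis ergM : ergodic_assumption M.

Lemma parent_arc (i j : 'I_n) : parent i = Some j -> arc j i.
Proof. by rewrite /parent /parent_of; case: pickP => // x ? [<-]. Qed.

Lemma depth_exists : exists dep : 'I_n -> nat,
  forall i j, parent i = Some j -> dep i = (dep j).+1.
Proof.
have [p Hp] := choice (@arc_tree _ M).
exists (fun i => size (p i)) => i j /parent_arc ji.
have [_ ui] := Hp i; have [[pj lj] _] := Hp j.
rewrite (ui (rcons (p j) i)) ?size_rcons //.
by rewrite rcons_path last_rcons pj lj.
Qed.

Lemma trans_common (i : 'I_n) u u' (z z' : local_policy) s s' :
  isSome u = isSome (parent i) -> u = u' -> z = z' ->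
  exists b, 0 < trans i b s u (z s) /\ 0 < trans i b s' u' (z' s').
Proof.
move=> hu <- <-.
apply: (@ergodic_bool_common R (fun s b => trans i b s u (z s))); last exact: ergM.
by move=> x; exact: trans_dist.
Qed.

Lemma global_stationaryP (zeta : policy M) mu :
  stationary (global_kernel zeta) mu <-> mu = stat_dist (global_kernel zeta).
Proof.
apply: stat_distP; have [dep Hdep] := depth_exists.
apply: (@product_kernel_stationary _ _ (global_step zeta) _ dep) => [i s|i x y xy].
  by apply: trans_dist; rewrite /parent; case: parent_of.
apply: trans_common => //; first by case: parent.
by case E: (parent i) => [j|] //=; rewrite xy // (Hdep _ _ E).
Qed.

Lemma kparentS k (i : 'I_n) : kparent k.+1 i = obind (@parent _ M) (kparent k i).
Proof. by []. Qed.

Lemma trunc_parent_Some k (i : 'I_n) (j : trunc_node k i) (p : 'I_n) :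
  (kparent k i == Some (val j)) = false -> parent (val j) = Some p ->
  exists2 p' : trunc_node k i, trunc_parent j = Some p' & val p' = p.
Proof.
case: j => j /= jD hk hp.
suff pD : p \in anc_path k i.
  by exists (exist _ p pD) => //; rewrite /trunc_parent /= hp /= insubT.
move: jD; rewrite /anc_path !mem_pmap => /mapP[l]; rewrite mem_iota add0n ltnS => /= lk jl.
have ltlk : (l < k)%N.
  by rewrite ltn_neqAle lk andbT; apply/eqP => lk'; rewrite -lk' -jl eqxx in hk.
have -> : Some p = kparent l.+1 i by rewrite kparentS -jl /= hp.
by apply: (map_f (fun l => kparent l i) (s := iota 0 k.+1)); rewrite mem_iota.
Qed.

Lemma trunc_stationaryP k (i : 'I_n) (zeta : trunc_policy k i) mu :
  stationary (trunc_kernel zeta) mu <-> mu = stat_dist (trunc_kernel zeta).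
Proof.
apply: stat_distP; have [dep Hdep] := depth_exists.
have psome (j : trunc_node k i) (s : {ffun trunc_node k i -> bool}) :
    (kparent k i == Some (val j)) = false ->
    isSome (omap s (trunc_parent j)) = isSome (parent (val j)).
  move=> hk; case E: (parent (val j)) => [p|]; last by rewrite /trunc_parent E.
  by have [p' -> _] := trunc_parent_Some hk E.
apply: (@product_kernel_stationary _ _ (trunc_step zeta) _ (dep \o val)) => [j s|j x y xy].
  rewrite /trunc_step; case hk: (kparent k i == _); last first.
    by apply: trans_dist; exact: psome.
  split=> [b|]; first by rewrite invr_ge0.
  by rewrite sumr_const card_bool -(mulr_natl (2^-1)) divff // pnatr_eq0.
rewrite /trunc_step; case hk: (kparent k i == _).
  by exists true; rewrite !invr_gt0 ltr0n.
apply: trans_common; [exact: psome| |by []].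
case E: (parent (val j)) => [p|]; last by rewrite /trunc_parent E.
have [p' -> p'p] := trunc_parent_Some hk E.
by rewrite /= xy //= p'p (Hdep _ _ E).
Qed.

End ModelTheory.

(* Main.v *)
Require Import Defs.
From mathcomp Require Import all_boot all_order all_algebra.
From mathcomp Require Import reals.
Import Order.TTheory GRing.Theory Num.Theory.
Local Open Scope ring_scope.

(** The reward of an agent is a linear functional of the marginal law of its
    state, so exchanging the true marginal for the truncated one changes it by
    at most the sup norm of the reward vector times the l1 distance between the
    two marginals ([ler_norm_sum_mul]); fast decay bounds that distance by
    [C * rho ^+ k].  The bound is the same for all agents, so it survives
    averaging over them ([ler_mean_norm_sub]). *)

(** Hoelder's inequality for the pairing of l-infinity with l1. *)
Lemma ler_norm_sum_mul (R : realDomainType) (I : finType) (b : R)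
    (r d : I -> R) :
  (forall x, `|r x| <= b) -> `|\sum_x r x * d x| <= b * \sum_x `|d x|.
Proof.
move=> rb; apply: le_trans (ler_norm_sum _ _ _) _.
by rewrite mulr_sumr; apply: ler_sum => x _; rewrite normrM ler_wpM2r.
Qed.

Lemma ler_mean_norm_sub (R : realFieldType) (n : nat) (B : R)
    (f g : 'I_n -> R) :
  (0 < n)%N -> (forall i, `|f i - g i| <= B) ->
  n%:R^-1 * `|\sum_i f i - \sum_i g i| <= B.
Proof.
move=> n_gt0 fgB; rewrite ler_pdivrMl ?ltr0n // -sumrB.
apply: le_trans (ler_norm_sum _ _ _) _.
apply: le_trans (ler_sum _ (fun i _ => fgB i)) _.
by rewrite sumr_const card_ord mulr_natl.
Qed.

Theorem lemma2 (R : realType) (M : instance R) (rbar C rho : R)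
    (ergM : ergodic_assumption M)
    (rewM : bounded_rewards M rbar)
    (decM : fast_decaying M C rho)
    (k : nat) (k_ge1 : (1 <= k)%N) (zeta : policy M) :
  (agents M)%:R^-1 * `|reward zeta - trunc_reward k zeta|
    <= C * rbar * rho ^+ k.
Proof.
apply: ler_mean_norm_sub => [|i]; first exact: agents_gt0.
have rbar_ge0 : 0 <= rbar by apply: le_trans (rewM i true).
rewrite /reward_at /trunc_reward_at -sumrB.
under eq_bigr => x _ do rewrite -mulrBr.
apply: le_trans (ler_norm_sum_mul _ _ _ _ _ (rewM i)) _.
by rewrite mulrAC [leRHS]mulrC ler_wpM2l // decM.
Qed.
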